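(* Let $\xi_0,\dots,\xi_n$ be iid random variables taking values $\pm1$ with probability $1/2$ each, and let $P_n(x)=\sum_{i=0}^n\xi_i x^i$. Let $p_{\pm1}=p_{\pm1}(n)$ be the probability that $P_n$ has a double root at $1$ or a double root at $-1$. Then $$\mathbf{P}\big(P_n \text{ has a real double root}\big)=p_{\pm1}+n^{-\omega(1)}.$$
   Context: A double root of $P_n$ is a point $x$ with $P_n(x)=P_n'(x)=0$; thus $p_{\pm1}=\mathbf{P}(P_n(1)=P_n'(1)=0 \text{ or } P_n(-1)=P_n'(-1)=0)$. The notation $n^{-\omega(1)}$ denotes a quantity which, for every fixed $C>0$, has absolute value at most $n^{-C}$ for all sufficiently large $n$. *)

(* Defs.v *)
From HB Require Import structures.
From mathcomp Require Import all_boot all_order all_algebra.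
From mathcomp Require Import all_classical all_reals all_analysis.

Set Implicit Arguments.
Unset Strict Implicit.
Unset Printing Implicit Defensive.

Import Order.TTheory GRing.Theory Num.Theory.
Import numFieldNormedType.Exports.

Local Open Scope classical_set_scope.
Local Open Scope ring_scope.

Definition mutually_independent (d : measure_display) (T : measurableType d)
    (R : realType) (P : probability T R) (I : finType)
    (X : I -> {RV P >-> R}) : Prop :=
  forall (J : {set I}) (A : I -> set R),
    (forall i, measurable (A i)) ->
    P (\bigcap_(i in [set` J]) (X i @^-1` A i)) =
    (\prod_(i in J) P (X i @^-1` A i))%E.

(* The law is only prescribed through P: X may take values other than 1 and -1
   on a P-null set. *)
Definition rademacher (d : measure_display) (T : measurableType d)
    (R : realType) (P : probability T R) (X : {RV P >-> R}) : Prop :=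
  P [set w | X w = 1] = (2^-1)%:E /\ P [set w | X w = -1] = (2^-1)%:E.

Definition iid_rademacher (d : measure_display) (T : measurableType d)
    (R : realType) (P : probability T R) (I : finType)
    (X : I -> {RV P >-> R}) : Prop :=
  mutually_independent X /\ forall i, rademacher (X i).

Definition random_poly (d : measure_display) (T : measurableType d)
    (R : realType) (P : probability T R) (n : nat)
    (xi : 'I_n.+1 -> {RV P >-> R}) (w : T) : {poly R} :=
  \sum_(i < n.+1) xi i w *: 'X^i.

Definition double_root (R : realType) (p : {poly R}) (x : R) : Prop :=
  p.[x] = 0 /\ p^`().[x] = 0.

(* e n = n^{-omega(1)} *)
Definition superpolynomially_small (R : realType) (e : nat -> R) : Prop :=
  forall C : R, 0 < C -> \forall n \near \oo, `|e n| <= n%:R `^ (- C).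

(* Main.v *)
(* Let P have signs as coefficients and a double root x <> 1, -1 in R; x is not
   0 either. The minimal polynomial f of x is monic with integer coefficients,
   f(0) <> 0, and f^2 divides P over Z. Let k = deg f and K = C log n.
   - If k >= K, reduce modulo 3. There are 3^k monic polynomials g of degree k
     over F_3, and g^2 divides at most a fraction 4^-k of the P, the 2k lowest
     coefficients being determined by the others: the total is about (3/4)^K.
   - If k < K, there are exp(O(log^2 n)) candidates for f, as its roots have
     modulus less than 2. Since f has a real root other than 1 and -1, it is not
     a product of cyclotomic polynomials, and an argument of Dobrowolski, with
     powers of 2 instead of large primes, yields a root al of f such that
     |al|^m >= 2 for some m = O(K^2). Then the signed sums of the powers
     1, al^m, al^2m, ... are distinct, so al is a root of at most a fraction
     2^-(n/m) of the P. *)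

Require Import Defs.
From HB Require Import structures.
From mathcomp Require Import all_boot all_order all_algebra.
From mathcomp Require Import all_classical all_reals all_analysis.
From mathcomp Require Import measurable_realfun complex ring lra zify.

Set Implicit Arguments.
Unset Strict Implicit.
Unset Printing Implicit Defensive.

Import Order.TTheory GRing.Theory Num.Theory.
Import numFieldNormedType.Exports.

Local Open Scope ring_scope.

(** * Power sums of conjugates modulo powers of 2 *)

Lemma dvdz_coef_scale (m : int) (p : {poly int}) :
  (forall i, (m %| p`_i)%Z) -> exists h, p = m *: h.
Proof.
move=> mp; have : p \is a polyOver (dvdz m) by apply/polyOverP.
rewrite -dvdz_contents => /dvdzP[c cE].
by exists (c *: zprimitive p); rewrite scalerA [m * c]mulrC -cE -zpolyEprim.
Qed.

(** Frobenius modulo 2: the cross terms are even, and [c ^+ 2] has the parity of [c]. *)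
Lemma sqr_poly_mod2 (p : {poly int}) :
  exists h, p ^+ 2 = p \Po 'X^2 + 2%:Z *: h.
Proof.
elim/poly_ind: p => [|p c [h ph]].
  by exists 0; rewrite comp_poly0 scaler0 expr0n addr0.
have [e ce] : exists e, c ^+ 2 = c + 2 * e.
  have := divz_eq c 2; set q := (c %/ 2)%Z => cE.
  have [r0|r1] : (c %% 2)%Z = 0 \/ (c %% 2)%Z = 1 by lia.
    by exists (2 * q ^+ 2 - q); rewrite cE r0; ring.
  by exists (2 * q ^+ 2 + q); rewrite cE r1; ring.
exists (h * 'X^2 + p * 'X * c%:P + e%:P).
rewrite comp_polyD comp_polyM comp_polyX comp_polyC -!mul_polyC.
rewrite -mul_polyC in ph.
transitivity (p ^+ 2 * 'X^2 + 2 * (p * 'X * c%:P) + (c ^+ 2)%:P).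
  by rewrite rmorphXn /=; ring.
rewrite ph ce polyCD polyCM; ring.
Qed.

Lemma comp_oppX_mod2 (p : {poly int}) :
  exists h, p \Po (- 'X) = p + 2%:Z *: h.
Proof.
elim/poly_ind: p => [|p c [h ph]].
  by exists 0; rewrite comp_poly0 scaler0 addr0.
exists (- p * 'X - h * 'X).
rewrite comp_polyD comp_polyM comp_polyX comp_polyC ph -!mul_polyC; ring.
Qed.

Lemma coef_comp_oppX (p : {poly int}) i : (p \Po (- 'X))`_i = (-1) ^+ i * p`_i.
Proof.
elim/poly_ind: p i => [|p c IH] i; first by rewrite comp_poly0 !coef0 mulr0.
rewrite comp_polyD comp_polyM comp_polyX comp_polyC !coefD !coefC mulrN coefN.
rewrite !coefMX; case: i => [|i] /=; first by rewrite expr0 oppr0; ring.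
by rewrite IH exprS; ring.
Qed.

(** Take determinants in [X^2 - A^2 = (X - A)(X + A)]: the last factor is minus the characteristic
    matrix of [A] taken at [-X], whence the sign. *)
Lemma char_poly_sqr (R : comNzRingType) n (A : 'M[R]_n) :
  char_poly (A *m A) \Po 'X^2 =
  (-1) ^+ n * (char_poly A * (char_poly A \Po (- 'X))).
Proof.
rewrite /char_poly -!det_map_mx /= -det_mulmx -detZ; congr (\det _).
rewrite /char_poly_mx !map_mxB /= !map_scalar_mx /= !comp_polyX.
rewrite -!map_mx_comp (eq_map_mx _ (fun c => comp_polyC c ('X^2 : {poly R}))).
rewrite (eq_map_mx _ (fun c => comp_polyC c (- 'X : {poly R}))) map_mxM /=.
set B := map_mx _ A.
have -> : (- 'X)%:M - B = - ('X%:M + B) :> 'M[{poly R}]_n.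
  by rewrite opprD raddfN.
rewrite mulmxN scaleN1r opprK mulmxBl !mulmxDr -scalar_mxM -expr2.
by rewrite (scalar_mxC 'X B) opprD addrA addrK.
Qed.

(* Graeffe's operator, which sends the characteristic polynomial of a matrix to
   that of its square, is the identity modulo 2 and maps polynomials congruent
   modulo [2 ^ a] to polynomials congruent modulo [2 ^ a.+1]. *)
Lemma dvdz_char_poly_iter_sqr k (B : 'M[int]_k.+1) a i :
  (2%:Z ^+ a.+1 %|
   (char_poly (B ^+ (2 ^ a.+1)))`_i - (char_poly (B ^+ (2 ^ a)))`_i)%Z.
Proof.
have Xn2 (p : {poly int}) j : (p \Po 'X^2)`_(2 * j) = p`_j.
  by rewrite coef_comp_poly_Xn // dvdn_mulr // mulKn.
have Bsq b : B ^+ (2 ^ b.+1) = B ^+ (2 ^ b) *m B ^+ (2 ^ b).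
  by rewrite expnS mul2n -addnn exprD.
elim: a i => [|a IH] i.
  set f := char_poly (B ^+ (2 ^ 0)).
  have [h1 E1] := sqr_poly_mod2 f; have [h2 E2] := comp_oppX_mod2 f.
  have [e Ee] : exists e, (-1) ^+ k.+1 = 1 + 2 * e :> {poly int}.
    rewrite -signr_odd; case: (odd _); last by exists 0; rewrite mulr0 addr0.
    by exists (-1); rewrite expr1; ring.
  have C2 : (2%:Z)%:P = 2 :> {poly int} by rewrite -polyC_natr.
  rewrite -(Xn2 _ i) Bsq char_poly_sqr -/f E2.
  have -> : (-1) ^+ k.+1 * (f * (f + 2%:Z *: h2)) =
     f \Po 'X^2 + 2%:Z *: (h1 + f * h2 + e * (f * (f + 2%:Z *: h2))).
    rewrite -!mul_polyC C2 in E1 *; rewrite Ee.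
    transitivity (f ^+ 2 + 2 * (f * h2 + e * (f * (f + 2 * h2))));
      first by ring.
    by rewrite E1; ring.
  by rewrite coefD Xn2 addrC addKr coefZ expr1 dvdz_mulr.
set m := 2%:Z ^+ a.+1 in IH.
set f := char_poly (B ^+ (2 ^ a)) in IH.
set g := char_poly (B ^+ (2 ^ a.+1)) in IH *.
have [h gE] : exists h, g - f = m *: h.
  by apply: dvdz_coef_scale => j; rewrite coefB.
have {}gE : g = f + m *: h by rewrite -gE addrC subrK.
rewrite -(Xn2 (char_poly _) i) -[X in (_ %| _ - X)%Z]Xn2.
rewrite (Bsq a.+1) char_poly_sqr -/g {1 2}gE.
rewrite /g Bsq char_poly_sqr -/f.
rewrite -coefB -mulrBr comp_polyD comp_polyZ.
have -> : (f + m *: h) * (f \Po - 'X + m *: (h \Po - 'X)) - f * (f \Po - 'X) =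
  m *: (f * (h \Po - 'X) + ((f * (h \Po - 'X)) \Po - 'X)
        + m *: (h * (h \Po - 'X))).
  have XX : (- 'X) \Po (- 'X) = 'X :> {poly int}.
    by rewrite -[X in X \Po _]sub0r comp_polyB comp_poly0 comp_polyX sub0r
      opprK.
  rewrite comp_polyM -comp_polyA XX comp_polyXr.
  by rewrite -!mul_polyC; ring.
rewrite -scalerAr coefZ.
have -> : 2%:Z ^+ a.+2 = m * 2 by rewrite [RHS]mulrC -exprS.
apply: dvdz_mul => //; rewrite -signr_odd.
have d2 : (2 %| m)%Z by rewrite /m exprS dvdz_mulr.
set u := f * _; set v := h * _.
(* The sign does not affect divisibility. In even degree the coefficient of [u + u(-X)] is twice
   that of [u], and [m] is even: this is the factor 2 gained. *)
suff dS : (2 %| (u + (u \Po - 'X) + m *: v)`_(2 * i))%Z.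
  by case: (odd k.+1); rewrite /= ?expr1 ?expr0 ?mulN1r ?mul1r ?coefN ?rpredN.
rewrite !coefD coef_comp_oppX exprM sqrrN !expr1n mul1r coefZ -mulr2n.
apply: rpredD; last exact: dvdz_mulr.
by apply/dvdzP; exists u`_(2 * i); rewrite mulr_natr.
Qed.

(** The trace is minus the subleading coefficient of the characteristic polynomial. *)
Lemma dvdz_tr_iter_sqr k (B : 'M[int]_k.+1) a :
  (2%:Z ^+ a.+1 %| \tr (B ^+ (2 ^ a.+1)) - \tr (B ^+ (2 ^ a)))%Z.
Proof.
have := dvdz_char_poly_iter_sqr B a k.
rewrite -[X in _`_X]/(k.+1.-1) !char_poly_trace // -opprD rpredN.
by [].
Qed.

Lemma diag_trig_mulmx (R : comNzRingType) n (A B : 'M[R]_n) :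
  is_trig_mx A -> is_trig_mx B ->
  is_trig_mx (A *m B) /\ forall i, (A *m B) i i = A i i * B i i.
Proof.
move=> /is_trig_mxP At /is_trig_mxP Bt; split.
  apply/is_trig_mxP => i j ij; rewrite mxE big1 // => l _.
  have [il|li] := ltnP i l; first by rewrite At ?mul0r.
  by rewrite Bt ?mulr0 // (leq_ltn_trans li).
move=> i; rewrite mxE (bigD1 i) //= big1 ?addr0 // => l li.
have [il|il|il] := ltngtP i l; first by rewrite At ?mul0r.
  by rewrite Bt ?mulr0.
by rewrite (val_inj il) eqxx in li.
Qed.

(** [A] is the companion matrix of [f]. Schur's theorem makes it triangular over [C], with the roots
    on the diagonal. Power sums of the roots thus become traces of integer matrices, to which the
    congruences modulo powers of 2 apply. *)
Lemma power_sums_trace (C : numClosedFieldType) (f : {poly int}) k :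
  f \is monic -> size f = k.+2 ->
  exists (al : 'I_k.+1 -> C) (A : 'M[int]_k.+1),
    map_poly intr f = \prod_i ('X - (al i)%:P) /\
    forall m, (\tr (A ^+ m))%:~R = \sum_i al i ^+ m.
Proof.
move=> fm sf.
have [A Af] : exists A : 'M[int]_k.+1, char_poly A = f.
  by move: (companionmx f) (companionmxK fm); rewrite sf /= => A; exists A.
pose B : 'M[C]_k.+1 := map_mx intr A.
have [Q /unitarymx_unit Qu] := @Schur C _ B isT.
rewrite /similar_to /= conjumx // => Tt.
set T := Q *m B *m invmx Q in Tt.
have BT : B = invmx Q *m T *m Q by rewrite /T !mulmxA mulVmx // mul1mx mulmxKV.
exists (fun i => T i i), A; split.
  rewrite -char_poly_trig // -Af map_char_poly -/B.
  rewrite /char_poly BT.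
  have -> : char_poly_mx (invmx Q *m T *m Q) =
     map_mx polyC (invmx Q) *m char_poly_mx T *m map_mx polyC Q.
    rewrite /char_poly_mx mulmxBr mulmxBl !map_mxM /=; congr (_ - _).
    by rewrite scalar_mxC -mulmxA -map_mxM mulVmx // map_mx1 mulmx1.
  rewrite !det_mulmx mulrAC -det_mulmx -map_mxM mulVmx // map_mx1 det1 mul1r.
  by [].
move=> m.
have Bm : map_mx intr (A ^+ m) = B ^+ m by rewrite /B rmorphXn.
transitivity (\tr (B ^+ m)).
  by rewrite -Bm /mxtrace rmorph_sum; apply: eq_bigr => i _; rewrite mxE.
have [Tmt Tmd] : is_trig_mx (T ^+ m) /\ forall i, (T ^+ m) i i = T i i ^+ m.
  elim: m {Bm} => [|m [IH1 IH2]].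
    by rewrite expr0; split=> [|i]; rewrite ?scalar_mx_is_trig // mxE eqxx.
  have [H1 H2] := diag_trig_mulmx Tt IH1.
  by rewrite exprS; split=> [//|i]; rewrite [LHS]H2 IH2 exprS.
have -> : B ^+ m = invmx Q *m T ^+ m *m Q.
  elim: m {Bm Tmt Tmd} => [|m IH]; first by rewrite !expr0 mulmx1 mulVmx.
  by rewrite !exprS IH {1}BT -!mulmxE !mulmxA mulmxK.
rewrite mxtrace_mulC mulmxA mulmxV // mul1mx.
by apply: eq_bigr => i _; rewrite Tmd.
Qed.

(** * A conjugate far from the unit circle *)

Lemma dvdz_small_eq (m x y : int) (b : nat) :
  (m %| x - y)%Z -> `|x| <= b%:Z -> `|y| <= b%:Z -> (2 * b)%:Z < m -> x = y.
Proof.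
move=> /dvdzP[q qE] xb yb bm; apply/eqP; rewrite -subr_eq0 qE.
have [->|q0] := eqVneq q 0; first by rewrite mul0r.
have : `|q * m| <= (2 * b)%:Z.
  rewrite -qE (le_trans (ler_normB _ _)) //.
  by rewrite mul2n -addnn PoszD lerD.
have q1 : 1 <= `|q| by lia.
rewrite normrM (@gtr0_norm _ m); last by lia.
nia.
Qed.

(* Were all conjugates that small, the 2-adic congruences between the power
   sums would be equalities, making the multiset of the [2^a]-th powers of the
   conjugates stable under squaring, at least as seen by polynomials of degree
   at most twice that of [f]; the square of a largest conjugate contradicts
   this. *)
Lemma house_lower_bound (C : numClosedFieldType) (f : {poly int}) k a (z : C) :
  f \is monic -> size f = k.+2 -> f`_0 != 0 ->
  root (map_poly intr f) z -> `|z| != 1 -> (6 * k.+1 < 2 ^ a.+1)%N ->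
  exists2 al : C, root (map_poly intr f) al &
    3 < `|al| ^+ (2 * k.+1 * 2 ^ a.+1).
Proof.
(* [N] is the largest exponent of a power sum used below: [j * 2 ^ a.+1], where [j] goes up to
   [2 * k.+1], the degree allowed to the test polynomial [q]. *)
move=> fm sf f0 fz z1 ka; set N := (2 * k.+1 * 2 ^ a.+1)%N.
have [al [A [fE trE]]] := power_sums_trace C fm sf.
have al_root i : root (map_poly intr f) (al i).
  by rewrite fE /root horner_prod (bigD1 i) //= hornerXsubC subrr mul0r.
case: (boolP [exists i, 3 < `|al i| ^+ N]) => [/existsP[i ?]|];
  first by exists (al i).
rewrite negb_exists => /forallP small; exfalso.
have al_le3 i m : (m <= N)%N -> `|al i| ^+ m <= 3.
  move=> mN; have [l1|l1] := real_leP (normr_real (al i)) (real1 C).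
    by rewrite (le_trans (exprn_ile1 _ (normr_ge0 _) l1)) ?ler1n.
  have := small i; rewrite -real_leNgt ?rpredX ?normr_real ?realn //.
  by apply: le_trans; rewrite ler_weXn2l // ltW.
have tr_le m : (m <= N)%N -> `|\tr (A ^+ m)| <= (3 * k.+1)%:Z.
  move=> mN; rewrite -(ler_int C) intr_norm trE.
  rewrite (le_trans (ler_norm_sum _ _ _)) // mulnC.
  have -> : ((k.+1 * 3)%N%:Z)%:~R = \sum_(i < k.+1) 3 :> C.
    by rewrite sumr_const card_ord -pmulrn natrM mulr_natl.
  by apply: ler_sum => i _; rewrite normrX al_le3.
(* Both traces are at most [3 * k.+1] in absolute value, and they are congruent modulo [2 ^ a.+1],
   which exceeds [6 * k.+1]. *)
have tr_eq j : (j <= 2 * k.+1)%N ->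
    \tr (A ^+ (j * 2 ^ a.+1)) = \tr (A ^+ (j * 2 ^ a)).
  move=> jk; apply: (@dvdz_small_eq (2%:Z ^+ a.+1) _ _ (3 * k.+1)).
  - by rewrite !exprM; apply: dvdz_tr_iter_sqr.
  - by apply: tr_le; rewrite leq_mul2r jk orbT.
  - by apply: tr_le; rewrite leq_mul // leq_exp2l.
  - by rewrite mulnA -!natz -natrX ltr_nat; exact: ka.
pose be i := al i ^+ (2 ^ a).
have sum_eq (q : {poly C}) : (size q <= (2 * k.+1).+1)%N ->
    \sum_i q.[be i ^+ 2] = \sum_i q.[be i].
  move=> sq.
  have ex (g : 'I_k.+1 -> C) : \sum_i q.[g i] =
      \sum_(j < (2 * k.+1).+1) q`_j * \sum_i g i ^+ j.
    transitivity (\sum_i \sum_(j < (2 * k.+1).+1) q`_j * g i ^+ j).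
      by apply: eq_bigr => i _; rewrite (horner_coef_wide _ sq).
    by rewrite exchange_big; apply: eq_bigr => j _; rewrite mulr_sumr.
  rewrite !ex; apply: eq_bigr => j _; congr (_ * _).
  have := tr_eq j; rewrite -ltnS ltn_ord =>
    /(_ isT) /(congr1 (intr : int -> C)).
  rewrite !trE => E; transitivity (\sum_i al i ^+ (j * 2 ^ a.+1)).
    by apply: eq_bigr => i _; rewrite /be -!exprM; congr (_ ^+ _);
      rewrite expnSr; lia.
  by rewrite E; apply: eq_bigr => i _; rewrite /be -exprM mulnC.
(* The product is the absolute value of the nonzero integer [f(0)]. As [z] is off the unit circle,
   some conjugate must then lie outside the closed disc. *)
have prod_ge1 : 1 <= \prod_i `|al i|.
  rewrite -normr_prod; have := congr1 (fun p => p.[0]) fE.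
  rewrite horner_prod horner_coef0 coef_map /= => /(congr1 Num.norm).
  rewrite normr_prod; under eq_bigr do rewrite hornerXsubC sub0r normrN.
  by rewrite -normr_prod => <-; rewrite -intr_norm ler1z -gtz0_ge1 normr_gt0.
have [i0 zi0] : exists i, z = al i.
  move: fz; rewrite fE /root horner_prod prodf_seq_eq0 => /hasP[i _].
  by rewrite /= hornerXsubC subr_eq0 => /eqP ->; exists i.
have [i1 i1P] : exists i, 1 < `|al i|.
  apply/existsP; apply: contraT; rewrite negb_exists => /forallP le1.
  have {}le1 i : `|al i| <= 1.
    by have := le1 i; rewrite -real_leNgt ?normr_real ?real1.
  have lt1 : `|al i0| < 1 by rewrite lt_neqAle le1 -zi0 z1.
  suff H : \prod_i `|al i| < 1 by have := le_lt_trans prod_ge1 H; rewrite ltxx.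
  rewrite (bigD1 i0) //= (le_lt_trans _ lt1) // ler_piMr //.
  by apply: prodr_ile1 => i _; rewrite normr_ge0 le1.
pose im := [arg max_(i > i1 | true) `|al i|]%O.
have [im1 imP] : 1 < `|al im| /\ forall i, `|al i| <= `|al im|.
  have al_real : {in xpredT, forall i, `|al i| \is Num.real}.
    by move=> i _; rewrite normr_real.
  rewrite /im; case: (@real_arg_maxP _ _ i1 _ _ isT al_real) => i _ H.
  by split=> [|j]; [apply: lt_le_trans i1P _ |]; apply: H.
pose ga := be im ^+ 2.
have ga0 : ga != 0.
  by rewrite /ga /be !expf_neq0 // -normr_gt0 (lt_trans _ im1).
have be_ga i : be i != ga.
  apply/eqP => /(congr1 Num.norm); rewrite /ga /be !normrX -exprM => E.
  have : `|al i| ^+ (2 ^ a) < `|al im| ^+ (2 ^ a * 2).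
    have le : `|al i| ^+ (2 ^ a) <= `|al im| ^+ (2 ^ a) by rewrite lerXn2r
      ?nnegrE.
    by rewrite (le_lt_trans le) // ltr_eXn2l // ltn_Pmulr // expn_gt0.
  by rewrite E ltxx.
pose P i := be i ^+ 2 != ga.
(* [q] vanishes at every [be i] and at every [be i ^+ 2] other than [ga], but not at [ga], which is
   larger than all [be i]. So its sum over the [be i] is 0, while its sum over their squares is a
   positive multiple of [q.[ga]]. Its degree is at most [1 + k.+1 + k], since [P] excludes [im]. *)
pose q := 'X * \prod_i ('X - (be i)%:P) * \prod_(i | P i) ('X - (be i ^+ 2)%:P).
have sq : (size q <= (2 * k.+1).+1)%N.
  have cP : (#|P| <= k)%N.
    have := max_card (predU1 im P); rewrite cardU1 card_ord /= /P /in_mem /=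
      eqxx.
    by rewrite add1n.
  have s1 : size (\prod_i ('X - (be i)%:P)) = k.+2.
    by rewrite size_prod_XsubC -count_predT -sum1_count sum1_card card_ord.
  have s2 : size (\prod_(i | P i) ('X - (be i ^+ 2)%:P)) = #|P|.+1.
    by rewrite -big_filter size_prod_XsubC size_filter -sum1_count sum1_card.
  have n1 : \prod_i ('X - (be i)%:P) != 0 by rewrite -size_poly_gt0 s1.
  have n2 : \prod_(i | P i) ('X - (be i ^+ 2)%:P) != 0 by rewrite
    -size_poly_gt0 s2.
  rewrite /q -mulrA mulrC size_mulX ?mulf_neq0 // size_mul // s1 s2.
  by rewrite addnS /= ltnS mul2n -addnn addSnnS leq_add2l ltnS.
have root_prod (Q : pred 'I_k.+1) (F : 'I_k.+1 -> C) i : Q i ->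
    (\prod_(j | Q j) ('X - (F j)%:P)).[F i] = 0.
  by move=> Qi; rewrite horner_prod (bigD1 i) //= hornerXsubC subrr mul0r.
have := sum_eq q sq.
rewrite [RHS]big1 => [|i _]; last by rewrite /q !hornerM root_prod //
  mulr0 mul0r.
rewrite (bigID P) /= big1 => [|i Pi]; last first.
  by rewrite /q hornerM (root_prod P (fun j => be j ^+ 2)) // mulr0.
rewrite add0r (eq_bigr (fun _ => q.[ga])) => [|i /negPn/eqP -> //].
have qga : q.[ga] != 0.
  rewrite /q !hornerM hornerX !horner_prod; apply: mulf_neq0.
    apply: mulf_neq0 => //; apply/prodf_neq0 => i _.
    by rewrite hornerXsubC subr_eq0 eq_sym.
  by apply/prodf_neq0 => i Pi; rewrite hornerXsubC subr_eq0 eq_sym.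
rewrite sumr_const => /eqP; rewrite mulrn_eq0 (negPf qga) orbF.
by move=> /eqP/card0_eq /(_ im); rewrite unfold_in /P negbK -/ga eqxx.
Qed.

(** [f] is the primitive part of a nonzero integer polynomial [q] of least degree vanishing at [x].
    By Gauss's lemma [p = f * g] over the integers, so [f] is monic. Minimality gives [f'(x) != 0];
    then [p'(x) = f'(x) g(x)] forces [g(x) = 0], and [f] divides [g] as well. *)
Lemma double_root_sqr_dvd (R : numFieldType) (p : {poly int}) (x : R) :
  lead_coef p = 1 \/ lead_coef p = -1 ->
  root (map_poly intr p) x -> root (map_poly intr p^`()) x ->
  exists f r : {poly int},
    [/\ f \is monic, p = f ^+ 2 * r & root (map_poly intr f) x].
Proof.
move=> lp px dpx; pose van (q : {poly int}) :=
  root (map_poly intr q : {poly R}) x.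
have p0 : p != 0 by rewrite -lead_coef_eq0; case: lp => ->.
have exP : exists m, `[< exists q, [/\ q != 0, van q & size q = m] >].
  by exists (size p); apply/asboolP; exists p.
case: (ex_minnP exP) => m /asboolP[q [q0 qx sq]] qmin.
have {}qmin g : van g -> g != 0 -> (size q <= size g)%N.
  by move=> gx g0; rewrite sq; apply: qmin; apply/asboolP; exists g.
have vanM a b : van (a * b) = van a || van b by rewrite /van rmorphM rootM.
(* The remainder of the pseudo-division by [q] also vanishes at [x], and is smaller than [q]. *)
have q_dvd g : van g -> q %| g.
  move=> gx; apply/contraT => ndvd.
  have [r0 rq] : modp g q != 0 /\ (size (modp g q) < size q)%N.
    by split; [exact: ndvd | rewrite ltn_modp].
  suff rx : van (modp g q) by have := qmin _ rx r0; rewrite leqNgt rq.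
  have E : modp g q = lead_coef q ^+ scalp g q *: g - divp g q * q.
    by rewrite Pdiv.Idomain.divp_eq addrC addKr.
  rewrite E /van rmorphB rmorphM /= map_polyZ /root hornerD hornerN hornerM
    hornerZ.
  by rewrite (rootP gx) (rootP qx) !mulr0 subrr.
pose f := zprimitive q.
have f0 : f != 0 by rewrite zprimitive_eq0.
have fx : van f.
  move: qx; rewrite /van {1}[q]zpolyEprim map_polyZ rootZ //.
  by rewrite intr_eq0 zcontents_eq0.
have [g pE] := dvdpP_int (q_dvd _ px).
have lf : lead_coef f = 1.
  have : sgz (lead_coef f) = 1 by rewrite sgz_lead_primitive q0.
  have : lead_coef f * lead_coef g = 1 \/ lead_coef f * lead_coef g = -1.
    by rewrite -lead_coefM -pE.
  move: (lead_coef f) (lead_coef g) => u v uv su.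
  have u0 : 0 < u by rewrite -sgz_gt0 su.
  have : (`|u| * `|v| = 1)%N by rewrite -abszM; case: uv => ->.
  by move/eqP; rewrite muln_eq1 => /andP[/eqP]; lia.
have gx : van g.
  have : van (f^`() * g).
    have := dpx; rewrite pE -/f derivM addrC rmorphD /= /root hornerD.
    by rewrite rmorphM hornerM (rootP fx) mul0r add0r.
  rewrite vanM => /orP[dfx|//]; exfalso.
  have sf : (1 < size f)%N.
    rewrite ltnNge; apply/negP => /size1_polyC fC.
    move: fx; rewrite /van fC map_polyC /= rootC intr_eq0 => /eqP f00.
    by move: f0; rewrite fC f00 eqxx.
  have df0 : f^`() != 0.
    apply/eqP => /polyP /(_ (size f).-2).
    by rewrite coef_deriv coef0 prednK -?subn1 ?subn_gt0 //
      subn1 -lead_coefE lf; lia.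
  have := qmin _ dfx df0; rewrite -(size_zprimitive q) leqNgt lt_size_deriv //.
have [r gE] := dvdpP_int (q_dvd _ gx).
by exists f, r; split; [apply/monicP | rewrite pE gE mulrA -expr2 |].
Qed.

(** * Counting sign polynomials *)

(** Littlewood polynomials with [n] coefficients. The base ring is a parameter, so that one sign
    vector is read over the integers, ['F_3], the reals and the complex numbers. *)
Definition littlewood (R : nzRingType) n (s : {ffun 'I_n -> bool}) : {poly R} :=
  \sum_(i < n) (-1) ^+ s i *: 'X^i.

Lemma coef_littlewood (R : nzRingType) n (s : {ffun 'I_n -> bool}) (i : 'I_n) :
  (littlewood R s)`_i = (-1) ^+ s i.
Proof.
rewrite coef_sum (bigD1 i) //= coefZ coefXn eqxx mulr1 big1 ?addr0 // => j ji.
by rewrite coefZ coefXn eq_sym val_eqE (negPf ji) mulr0.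
Qed.

Lemma size_littlewood (R : nzRingType) n (s : {ffun 'I_n -> bool}) :
  size (littlewood R s) = n.
Proof.
apply/eqP; rewrite eqn_leq; apply/andP; split.
  apply/leq_sizeP => j nj; rewrite coef_sum big1 // => i _.
  by rewrite coefZ coefXn gtn_eqF ?mulr0 // (leq_trans _ nj).
case: n s => // n s; have := coef_littlewood R s ord_max => /= sE.
by rewrite ltnNge; apply/negP => /leq_sizeP/(_ n (leqnn n))/eqP;
  rewrite sE signr_eq0.
Qed.

Lemma lead_coef_littlewood (R : nzRingType) n (s : {ffun 'I_n.+1 -> bool}) :
  lead_coef (littlewood R s) = (-1) ^+ s ord_max.
Proof. by rewrite lead_coefE size_littlewood -(coef_littlewood R s ord_max).
  Qed.

Lemma map_littlewood (R S : nzRingType) (f : {rmorphism R -> S}) n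
    (s : {ffun 'I_n -> bool}) :
  map_poly f (littlewood R s) = littlewood S s.
Proof.
rewrite /littlewood rmorph_sum; apply: eq_bigr => i _ /=.
by rewrite map_polyZ rmorph_sign map_polyXn.
Qed.

Lemma card_le_pow2 (I : finType) (S : {set {ffun I -> bool}}) (D : {set I}) :
  (forall s t, s \in S -> t \in S -> {in D, s =1 t} -> s = t) ->
  (#|S| <= 2 ^ #|D|)%N.
Proof.
move=> Sinj; rewrite -card_powerset -(card_in_imset (f :=
  fun s : {ffun I -> bool} => D :&: [set i | s i])).
  by apply/subset_leq_card/fintype.subsetP => _ /imsetP[s _ ->];
    rewrite powersetE finset.subsetIl.
move=> s t sS tS st; apply: Sinj => // i iD.
by have /setP/(_ i) := st; rewrite !inE iD.
Qed.

(* The coefficients of index at least [size h - 1] determine the others. *)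
Lemma card_littlewood_dvd (F : fieldType) n (h : {poly F}) :
  (2 : F) != 0 -> h != 0 ->
  (#|[set s : {ffun 'I_n -> bool} | (h %| littlewood F s)%R]| <= 2 ^ (n -
    (size h).-1))%N.
Proof.
move=> two0 h0; have := @card_le_pow2 'I_n
  [set s : {ffun 'I_n -> bool} | (h %| littlewood F s)%R] [set i :
    'I_n | ((size h).-1 <= i)%N].
have -> : #|[set i : 'I_n | ((size h).-1 <= i)%N]| = (n - (size h).-1)%N.
  have [nh|hn] := leqP n (size h).-1.
    rewrite (eqP (_ : n - _ == 0)%N) ?subn_eq0 //; apply: eq_card0 => i.
    by rewrite inE leqNgt (leq_trans (ltn_ord i)).
  rewrite -[RHS]card_ord.
  have sn : ((size h).-1 + (n - (size h).-1) = n)%N by rewrite subnKC // ltnW.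
  pose g (i : 'I_(n - (size h).-1)) : 'I_n := cast_ord sn (rshift _ i).
  have gi : injective g by move=> i j /cast_ord_inj /rshift_inj.
  rewrite -(card_codom gi); apply: eq_card => i; rewrite inE.
  apply/idP/codomP => [hi|[j ->]]; last by rewrite /= leq_addr.
  have ii : (i - (size h).-1 < n - (size h).-1)%N by rewrite ltn_sub2r //
    (leq_ltn_trans hi).
  by exists (Ordinal ii); apply: val_inj; rewrite /= subnKC.
apply=> s t; rewrite !inE => hs ht st.
have : h %| littlewood F s - littlewood F t by rewrite dvdp_sub.
move=> hst; have E : littlewood F s = littlewood F t.
  (* The difference is a multiple of [h] with no coefficient from index [(size h).-1] on: its degree
     is too small unless it is 0. *)
  apply/eqP; rewrite -subr_eq0; apply: contraT => st0.
  have : (size (littlewood F s - littlewood F t)%R <= (size h).-1)%N.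
    apply/leq_sizeP => j hj; have [jn|nj] := ltnP j n; last first.
      by rewrite coefB !nth_default ?size_littlewood // subr0.
    by rewrite coefB -[j]/(val (Ordinal jn)) !coef_littlewood st ?inE ?subrr.
  move/(leq_trans (dvdp_leq st0 hst)); rewrite -size_poly_gt0 in h0.
  by case: (size h) h0 => // m _; rewrite ltnn.
apply/ffunP => i; have /polyP/(_ i) := E; rewrite !coef_littlewood.
case: (s i) (t i) => [] [] //= /eqP; rewrite ?expr0 ?expr1.
  by rewrite eq_sym -subr_eq0 opprK (negPf two0).
by rewrite -subr_eq0 opprK (negPf two0).
Qed.

(** With [B = b ^+ m >= 2], this is [1 + B + ... + B^(J-1) < B^J]. *)
Lemma sum_multiples_lt (C : numDomainType) (b : C) m J :
  (0 < m)%N -> 0 <= b -> 2 <= b ^+ m ->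
  \sum_(0 <= l < J * m | (m %| l)%N) b ^+ l < b ^+ (J * m).
Proof.
move=> m0 b0 bm; elim: J => [|J IH].
  by rewrite mul0n big_geq // expr0 ltr01.
rewrite (@big_cat_nat _ _ _ (J * m)) //=; last by rewrite leq_mul2r leqnSn orbT.
rewrite [X in _ + X]big_ltn_cond ?ltn_mul2r ?m0 ?ltnSn // dvdn_mull //.
rewrite [X in _ + (_ + X)]big_nat_cond [X in _ + (_ + X)]big_pred0 => [|l];
  last first.
  apply/negbTE/negP => /andP[/andP[l1 l2] /dvdnP[q ql]]; move: l1 l2.
  by rewrite ql !ltn_mul2r m0 /= ltnS => l1 /(leq_trans l1); rewrite ltnn.
rewrite addr0 mulSn addnC exprD.
have bJ : 0 <= b ^+ (J * m) by rewrite exprn_ge0.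
apply: (@lt_le_trans _ _ (b ^+ (J * m) * 2)); last exact: ler_wpM2l.
by rewrite mulr_natr mulr2n ltrD2r.
Qed.

(** The term of index [i] outweighs all the lower ones together, by [sum_multiples_lt]. *)
Lemma lacunary_sum_neq0 (C : numDomainType) (b : C) m n (c : 'I_n -> C) (i :
  'I_n) :
  (0 < m)%N -> 2 <= `|b| ^+ m -> (m %| i)%N -> c i != 0 ->
  (forall l : 'I_n, (i < l)%N -> c l = 0) ->
  (forall l : 'I_n, ~~ (m %| l)%N -> c l = 0) ->
  (forall l, `|c l| <= `|c i|) -> \sum_l c l * b ^+ l != 0.
Proof.
move=> m0 bm mi ci chigh cmul cle; rewrite (bigD1 i) //= addr_eq0.
apply/negP => /eqP /(congr1 Num.norm); rewrite normrN normrM normrX => E.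
have : `|c i| * `|b| ^+ i <= \sum_(0 <= l < i | (m %| l)%N) `|c i| * `|b| ^+ l.
  rewrite {}E (le_trans (ler_norm_sum _ _ _)) //
    (big_nat_widen _ _ n) ?(ltnW (ltn_ord i)) //.
  rewrite big_mkord [leLHS](bigID (fun l : 'I_n => (m %| l)%N && (l < i)%N)) /=.
  rewrite [X in _ + X]big1 ?addr0 => [|l /andP[li]]; last first.
    rewrite negb_and -leqNgt => /orP[ml|il];
      first by rewrite cmul // mul0r normr0.
    by rewrite chigh ?mul0r ?normr0 // ltn_neqAle eq_sym li il.
  rewrite [leLHS](eq_bigl (fun l : 'I_n => (m %| l)%N && (l < i)%N)) => [|l];
    last first.
    by case: eqVneq => [->|//]; rewrite ltnn andbF.
  by apply: ler_sum => l _; rewrite normrM normrX ler_wpM2r ?exprn_ge0.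
rewrite -mulr_sumr ler_pM2l ?normr_gt0 //.
have /dvdnP[J ->] := mi => H.
by have := le_lt_trans H (sum_multiples_lt J m0 (normr_ge0 b) bm); rewrite ltxx.
Qed.

Lemma horner_littlewood (R : comNzRingType) n (s : {ffun 'I_n -> bool}) (x :
  R) :
  (littlewood R s).[x] = \sum_(i < n) (-1) ^+ s i * x ^+ i.
Proof. by rewrite horner_sum; apply: eq_bigr => i _;
  rewrite hornerZ hornerXn. Qed.

Lemma card_dvd_multiples n m :
  (0 < m)%N -> (n %/ m < #|[set i : 'I_n.+1 | (m %| i)%N]|)%N.
Proof.
move=> m0; pose g (j : 'I_(n %/ m).+1) : 'I_n.+1 := inord (j * m).
have gE j : g j = (j * m)%N :> nat.
  by rewrite inordK // ltnS (leq_trans _ (leq_trunc_div n m)) //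
    leq_mul2r -ltnS ltn_ord orbT.
have gi : injective g.
  move=> i j /(congr1 val); rewrite /= !gE => /eqP;
    rewrite eqn_mul2r -leqn0 leqNgt m0.
  by move/eqP/val_inj.
apply: (@leq_trans #|g @: [set: 'I_(n %/ m).+1]|).
  by rewrite card_imset // cardsT card_ord.
apply/subset_leq_card/fintype.subsetP => _ /imsetP[j _ ->].
by rewrite inE gE dvdn_mull.
Qed.

(* Differences of signs at multiples of [m] are determined by the top one. *)
Lemma card_littlewood_root (C : numDomainType) n m (al : C) :
  (0 < m)%N -> 2 <= `|al| ^+ m ->
  (#|[set s : {ffun 'I_n.+1 -> bool} | root (littlewood C s) al]| * 2 ^ (n %/ m)
    <= 2 ^ n.+1)%N.
Proof.
move=> m0 alm; set S := [set s | _].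
have SD : (#|S| <= 2 ^ #|~: [set i : 'I_n.+1 | (m %| i)%N]|)%N.
  apply: card_le_pow2 => s t; rewrite !inE => rs rt st.
  apply/eqP; apply: contraT => nst.
  have [i0 i0P] : exists i, s i != t i.
    apply/existsP; apply: contraNT nst; rewrite negb_exists => /forallP H.
    by apply/eqP/ffunP => i; apply/eqP; rewrite -[_ == _]negbK H.
  (* The top index of disagreement is a multiple of [m], as [s] and [t] agree elsewhere. The
     differences [c l] are 0 or of modulus 2, so none exceeds [c i]. *)
  pose i := [arg max_(i > i0 | s i != t i) (i : nat)]%N.
  have [sti imax] : s i != t i /\ forall j, s j != t j -> (j <= i)%N.
    by rewrite /i; case: arg_maxnP.
  pose c l : C := (-1) ^+ s l - (-1) ^+ t l.
  have c0 l : s l = t l -> c l = 0 by rewrite /c => ->; rewrite subrr.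
  have c2 l : s l != t l -> `|c l| = 2.
    rewrite /c; case: (s l) (t l) => [] [] //= _; rewrite ?expr0 ?expr1.
      by rewrite -opprD normrN -[1 + 1]/(2%:R) normr_nat.
    by rewrite opprK -[1 + 1]/(2%:R) normr_nat.
  have cm (l : 'I_n.+1) : ~~ (m %| l)%N -> c l = 0 by move=> ml;
    rewrite c0 // st // !inE.
  have ci : c i != 0 by rewrite -normr_eq0 c2 // pnatr_eq0.
  have mi : (m %| i)%N by apply: contraNT ci => /cm ->.
  suff : \sum_l c l * al ^+ l != 0.
    under eq_bigr do rewrite /c mulrBl.
    by rewrite sumrB -!horner_littlewood (rootP rs) (rootP rt) subrr eqxx.
  apply: (@lacunary_sum_neq0 _ _ m _ _ i) => // l.
    move=> il; apply: c0; apply/eqP; apply: contraTT il => /imax.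
    by rewrite -leqNgt.
  have [/c0 ->|/c2 ->] := eqVneq (s l) (t l); first by rewrite normr0.
  by rewrite c2.
rewrite (leq_trans (leq_mul SD (leqnn _))) // -expnD leq_exp2l //.
rewrite cardsCs finset.setCK card_ord.
have := card_dvd_multiples n m0;
  have := subset_leq_card (finset.subsetT [set i : 'I_n.+1 | (m %| i)%N]).
by rewrite cardsT card_ord; lia.
Qed.

(** The case [m = 1] of the lacunary estimate: if [|z| >= 2], the leading term dominates. *)
Lemma littlewood_root_lt2 (C : numDomainType) n (s :
  {ffun 'I_n.+1 -> bool}) (z : C) :
  root (littlewood C s) z -> `|z| < 2.
Proof.
move=> rz; rewrite real_ltNge ?normr_real ?realn //; apply/negP => z2.
have : \sum_(l < n.+1) (-1) ^+ s l * z ^+ l != 0.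
  apply: (@lacunary_sum_neq0 _ _ 1 _ _ ord_max) => //.
  - by rewrite signr_eq0.
  - by move=> l /=; rewrite ltnNge -ltnS ltn_ord.
  - by move=> l; rewrite dvd1n.
  - by move=> l; rewrite !normr_sign.
by rewrite -horner_littlewood (rootP rz) eqxx.
Qed.

(** Each factor [X - x] multiplies the bound on the coefficients by at most [1 + 2]. *)
Lemma coef_prod_XsubC_le (C : numDomainType) (r : seq C) j :
  (forall x, x \in r -> `|x| <= 2) ->
  `|(\prod_(x <- r) ('X - x%:P))`_j| <= 3 ^+ size r.
Proof.
elim: r j => [|x r IH] j rle /=.
  by rewrite big_nil coef1 expr0; case: eqP; rewrite ?normr1 ?normr0.
rewrite big_cons mulrBl coefB coefXM coefCM exprS.
have {}IH i : `|(\prod_(x <- r) ('X - x%:P))`_i| <= 3 ^+ size r.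
  by apply: IH => y yr; rewrite rle // inE yr orbT.
apply: (@le_trans _ _ (3 ^+ size r + 2 * 3 ^+ size r)).
  rewrite (le_trans (ler_normB _ _)) // lerD //.
    by case: ifP => _; rewrite ?normr0 ?exprn_ge0.
  by rewrite normrM ler_pM // rle // mem_head.
by rewrite -{1}[3 ^+ _]mul1r -mulrDl -[1 + 2]/(1%:R + 2%:R) -natrD.
Qed.

Lemma card_bigcup_le (I T : finType) (P : pred I) (S : I -> {set T}) c :
  (forall i, P i -> #|S i| <= c)%N -> (#|\bigcup_(i | P i) S i| <= #|I| * c)%N.
Proof.
move=> Sc; apply: (@leq_trans (\sum_(i | P i) #|S i|)).
  elim/big_rec2: _ => [|i n A Pi]; first by rewrite cards0.
  by move=> nA; rewrite (leq_trans (leq_card_setU _ _)) // leq_add2l.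
rewrite (leq_trans (leq_sum _ Sc)) // sum_nat_const leq_mul2r.
by rewrite max_card orbT.
Qed.

Lemma monic_coefs (R : nzRingType) k (f : {poly R}) :
  f \is monic -> size f = k.+1 ->
  exists g : {ffun 'I_k -> R}, f = \sum_(i < k) g i *: 'X^i + 'X^k.
Proof.
move=> fm sf; exists [ffun i : 'I_k => f`_i].
have fk : f`_k = 1 by have /monicP := fm; rewrite lead_coefE sf.
rewrite -{1}(coefK f) sf poly_def big_ord_recr /= fk scale1r; congr (_ + _).
by apply: eq_bigr => i _; rewrite ffunE.
Qed.

(* Divisors of large degree are excluded modulo 3: there are [3 ^ k] candidates
   of degree [k], whose squares divide at most a fraction [4 ^- k] of the
   polynomials. *)
Lemma card_littlewood_sqr_dvd n K :
  (#|[set s : {ffun 'I_n.+1 -> bool} | [exists k : 'I_n.+1, (K <= k)%N &&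
       [exists g : {ffun 'I_k -> 'F_3},
          ((\sum_(i < k) g i *: 'X^i + 'X^k) ^+ 2 %| littlewood 'F_3 s)%R]]]|
            * 4 ^ K
   <= n.+1 * 3 ^ K * 2 ^ n.+1)%N.
Proof.
pose f k (g : {ffun 'I_k -> 'F_3}) : {poly 'F_3} :=
  \sum_(i < k) g i *: 'X^i + 'X^k.
pose S (k : nat) g := [set s : {ffun 'I_n.+1 -> bool} | (f k g ^+ 2 %|
  littlewood 'F_3 s)%R].
have sfX k (g : {ffun 'I_k -> 'F_3}) : size (f k g) = k.+1.
  rewrite /f addrC size_addl size_polyXn // ltnS; apply/leq_sizeP => j kj.
  rewrite coef_sum big1 // => i _.
  by rewrite coefZ coefXn gtn_eqF ?mulr0 // (leq_trans _ kj).
have f0 k (g : {ffun 'I_k -> 'F_3}) : f k g != 0 by rewrite -size_poly_gt0 sfX.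
have sf2 k (g : {ffun 'I_k -> 'F_3}) : (size (f k g ^+ 2)).-1 = (2 * k)%N.
  by rewrite expr2 size_mul // sfX; lia.
have cS (k : nat) g : (K <= k)%N -> (#|S k g| * 4 ^ k <= 2 ^ n.+1)%N.
  (* An element of [S k g] forces [2 * k < n.+1], so the truncated subtraction in
     [card_littlewood_dvd] is exact. *)
  move=> Kk; have [->|[s]] := set_0Vmem (S k g); first by rewrite cards0.
  rewrite inE => /dvdp_leq; rewrite -size_poly_gt0 size_littlewood => /(_ isT).
  have -> : size (f k g ^+ 2) = (2 * k).+1.
    by rewrite -(sf2 k g) prednK // size_poly_gt0 expf_neq0.
  move=> kn; have := @card_littlewood_dvd 'F_3 n.+1 (f k g ^+ 2) isT
    (expf_neq0 2 (f0 k g)).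
  rewrite sf2 -/(S k g) -(leq_pmul2r (_ : 0 < 4 ^ k)%N) ?expn_gt0 // =>
    /leq_trans -> //.
  by rewrite -(expnM 2 2 k) -expnD leq_exp2l // subnK // ltnW.
pose U (k : 'I_n.+1) := if (K <= k)%N then \bigcup_(g :
  {ffun 'I_k -> 'F_3}) S k g else finset.set0.
have cU k : (#|U k| * 4 ^ K <= 3 ^ K * 2 ^ n.+1)%N.
  rewrite /U; case: ifP => Kk; last by rewrite cards0.
  have H : (#|\bigcup_(g : {ffun 'I_k -> 'F_3}) S k g| * 4 ^ k <= 3 ^ k * 2 ^
    n.+1)%N.
    have cS' (g : {ffun 'I_k -> 'F_3}) :
      true -> (#|S k g| <= 2 ^ n.+1 %/ 4 ^ k)%N.
      by move=> _; rewrite leq_divRL ?expn_gt0 // cS.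
    have := @card_bigcup_le _ _ xpredT _ _ cS';
      rewrite card_ffun card_Fp // card_ord.
    move=> /(leq_mul (leqnn (4 ^ k)%N)); rewrite mulnC => /leq_trans -> //.
    by rewrite mulnCA leq_mul2l mulnC leq_trunc_div orbT.
  (* The bound for degree [k] is no worse than that for [K], since [3 ^ (k - K) <= 4 ^ (k - K)]. *)
  rewrite -(leq_pmul2r (_ : 0 < 4 ^ (k - K))%N) ?expn_gt0 //.
  rewrite -mulnA -expnD subnKC // (leq_trans H) // mulnAC leq_mul2r.
  have mono j : (3 ^ j <= 4 ^ j)%N by elim: j => // j IH;
    rewrite !expnS leq_mul.
  by rewrite -{1}(subnKC Kk) expnD leq_mul2l mono !orbT.
apply: (@leq_trans (#|\bigcup_k U k| * 4 ^ K)).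
  rewrite leq_mul2r; apply/orP; right;
    apply/subset_leq_card/fintype.subsetP => s.
  rewrite inE => /existsP[k /andP[Kk /existsP[g gs]]]; apply/finset.bigcupP;
    exists k => //.
  by rewrite /U Kk; apply/finset.bigcupP; exists g; rewrite ?inE.
have cU' (k : 'I_n.+1) : true -> (#|U k| <= 3 ^ K * 2 ^ n.+1 %/ 4 ^ K)%N.
  by move=> _; rewrite leq_divRL ?expn_gt0.
have := card_bigcup_le cU'; rewrite card_ord => /(leq_mul (leqnn (4 ^ K)%N)).
rewrite mulnC => /leq_trans -> //.
by rewrite mulnCA -mulnA leq_mul2l mulnC leq_trunc_div orbT.
Qed.

(* A divisor of small degree has integer coefficients of absolute value at
   most [3 ^ K], since its roots have modulus less than 2. *)
Lemma card_littlewood_small_dvd (C : numClosedFieldType) n K m :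
  (0 < m)%N ->
  (#|[set s : {ffun 'I_n.+1 -> bool} | `[< exists (f r : {poly int}) (al : C),
       [/\ f \is monic, (size f <= K)%N, (littlewood int s = f * r)%R,
           root (map_poly intr f) al & (2 <= `|al| ^+ m)%R] >]]| * 2 ^ (n %/ m)
   <= (2 * 3 ^ K).+1 ^ K * 2 ^ n.+1)%N.
Proof.
move=> m0; set X := [set s | _].
(* Integers between [- 3 ^ K] and [3 ^ K] are encoded as ordinals by adding [3 ^ K]. *)
pose dec (g : {ffun 'I_K -> 'I_(2 * 3 ^ K).+1}) : {poly int} :=
  \sum_(i < K) ((g i)%:Z - (3 ^ K)%:Z) *: 'X^i.
pose U g := if `[< exists2 al : C,
  root (map_poly intr (dec g)) al & 2 <= `|al| ^+ m >]
  then [set s : {ffun 'I_n.+1 -> bool} | `[< exists r,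
    littlewood int s = dec g * r >]]
  else finset.set0.
have cU g : true -> (#|U g| <= 2 ^ n.+1 %/ 2 ^ (n %/ m))%N.
  move=> _; rewrite leq_divRL ?expn_gt0 // /U.
  case: ifP => [/asboolP[al gal al2]|_]; last by rewrite cards0.
  apply: leq_trans (card_littlewood_root n m0 al2).
  rewrite leq_mul2r; apply/orP; right;
    apply/subset_leq_card/fintype.subsetP => s.
  rewrite !finset.in_set => /asboolP[r sr].
  by rewrite -(map_littlewood intr s) sr rmorphM rootM gal.
apply: (@leq_trans (#|\bigcup_g U g| * 2 ^ (n %/ m))); last first.
  have := card_bigcup_le cU; rewrite card_ffun !card_ord.
  move=> /(leq_mul (leqnn (2 ^ (n %/ m))%N)); rewrite mulnC => /leq_trans -> //.
  by rewrite mulnCA leq_mul2l (mulnC (2 ^ (n %/ m))%N) leq_trunc_div orbT.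
rewrite leq_mul2r; apply/orP; right; apply/subset_leq_card/fintype.subsetP => s.
rewrite inE => /asboolP[f [r [al [fm sf sE fal al2]]]].
have f_le i : `|f`_i| <= (3 ^ K)%:Z.
  have [rs fE] := closed_field_poly_normal (map_poly intr f : {poly C}).
  have lf : lead_coef (map_poly intr f : {poly C}) = 1.
    by apply/monicP; rewrite monic_map.
  rewrite lf scale1r in fE.
  have srs : (size rs <= K)%N.
    have := congr1 (fun p : {poly C} => size p) fE.
    rewrite size_prod_XsubC size_map_inj_poly ?rmorph0 //; last exact: intr_inj.
    by move=> E; rewrite (leq_trans _ sf) // E.
  rewrite -(ler_int C) intr_norm -(coef_map intr) /= fE.
  apply: (@le_trans _ _ (3 ^+ size rs)).
    apply: coef_prod_XsubC_le => x xrs; apply/ltW/(@littlewood_root_lt2 _ n s).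
    rewrite -(map_littlewood intr s) sE rmorphM /= rootM fE root_prod_XsubC xrs.
    by [].
  by rewrite -pmulrn natrX ler_weXn2l // ler1n.
pose g := [ffun i : 'I_K => inord (absz (f`_i + (3 ^ K)%:Z)) :
  'I_(2 * 3 ^ K).+1].
have gE : dec g = f.
  apply/polyP => i; rewrite coef_sum; have [iK|Ki] := ltnP i K; last first.
    rewrite big1 => [|j _]; first by rewrite nth_default // (leq_trans sf).
    by rewrite coefZ coefXn gtn_eqF ?mulr0 // (leq_trans _ Ki).
  rewrite (bigD1 (Ordinal iK)) //= coefZ coefXn eqxx mulr1 big1 ?addr0 =>
    [|j ji].
    rewrite ffunE inordK /=; have := f_le i; set c := f`_i;
      set M := (3 ^ K)%N; lia.
  by move: ji; rewrite -val_eqE eq_sym coefZ coefXn => /negPf ->; rewrite mulr0.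
apply/finset.bigcupP; exists g => //; rewrite /U gE; case: asboolP => [_|[]];
  last by exists al.
by rewrite inE; apply/asboolP; exists r.
Qed.

(** [B] joins the two sets counted above. The square factor [f] of [littlewood int s] either has
    size at most [K], and [house_lower_bound] provides a large root, or has degree at least [K], and
    its reduction modulo 3 keeps this degree because [f] is monic. *)
Lemma card_real_double_root (R : rcfType) n K a :
  (0 < K)%N -> (6 * K < 2 ^ a.+1)%N ->
  exists B : {set {ffun 'I_n.+1 -> bool}},
  [/\ forall s (x : R), root (littlewood R s) x -> root (littlewood R s)^`() x
    ->
        `|x| != 1 -> s \in B &
    exists b c : nat, [/\ (#|B| <= b + c)%N,
      (b * 2 ^ (n %/ (2 * K * 2 ^ a.+1)) <= (2 * 3 ^ K).+1 ^ K * 2 ^ n.+1)%N &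
      (c * 4 ^ K <= n.+1 * 3 ^ K * 2 ^ n.+1)%N]].
Proof.
move=> K0 Ka; pose m := (2 * K * 2 ^ a.+1)%N.
have m0 : (0 < m)%N by rewrite !muln_gt0 K0 expn_gt0.
pose B1 := [set s : {ffun 'I_n.+1 -> bool} | `[< exists (f r :
  {poly int}) (al : R[i]),
       [/\ f \is monic, (size f <= K)%N, (littlewood int s = f * r)%R,
           root (map_poly intr f) al & (2 <= `|al| ^+ m)%R] >]].
pose B2 := [set s : {ffun 'I_n.+1 -> bool} | [exists k : 'I_n.+1, (K <= k)%N &&
       [exists g : {ffun 'I_k -> 'F_3},
          ((\sum_(i < k) g i *: 'X^i + 'X^k) ^+ 2 %| littlewood 'F_3 s)%R]]].
exists (B1 :|: B2); split; last first.
  exists #|B1|, #|B2|; split; first by rewrite (leq_card_setU _ _).1.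
    exact: card_littlewood_small_dvd.
  exact: card_littlewood_sqr_dvd.
move=> s x sx dsx x1.
have ls : lead_coef (littlewood int s) = 1 \/ lead_coef (littlewood int s) = -1.
  by rewrite lead_coef_littlewood; case: (s _); [right|left].
have [||f [r [fm sE fx]]] := @double_root_sqr_dvd R _ x ls.
- by rewrite map_littlewood.
- by rewrite -deriv_map map_littlewood.
have fsz : (1 < size f)%N.
  rewrite ltnNge; apply/negP => /size1_polyC fC.
  move: fx; rewrite fC map_polyC /= rootC intr_eq0 => /eqP f00.
  by have := monic_neq0 fm; rewrite fC f00 eqxx.
rewrite inE; have [szK|Ksz] := leqP (size f) K; apply/orP; [left|right].
  have [k sf] : exists k, size f = k.+2.
    by exists (size f).-2; move: fsz; case: (size f) => [|[|]].
  have f0 : f`_0 != 0.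
    have : (littlewood int s)`_0 != 0.
      by rewrite (coef_littlewood int s ord0) signr_eq0.
    by apply: contraNneq => f0; rewrite sE expr2 -mulrA coef0M f0 mul0r.
  have fxC : root (map_poly intr f) (x%:C)%C.
    have -> : map_poly intr f = map_poly (real_complex R) (map_poly intr f).
      by rewrite -map_poly_comp; apply: eq_map_poly => c /=; rewrite rmorph_int.
    by rewrite fmorph_root.
  have xC1 : `|(x%:C)%C| != 1.
    rewrite normc_def /= expr0n /= addr0 sqrtr_sqr; apply: contraNneq x1.
    by move=> /complexI ->.
  have ka : (6 * k.+1 < 2 ^ a.+1)%N.
    by rewrite (leq_ltn_trans _ Ka) // leq_mul2l /= ltnW // -sf.
  have [al fal al3] := house_lower_bound fm sf f0 fxC xC1 ka.
  rewrite inE; apply/asboolP; exists f, (f * r), al; split=> //.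
    by rewrite sE expr2 mulrA.
  (* This allows the exponent, which depends on the degree of [f], to be raised to the common value
     [m]. *)
  have al1 : 1 <= `|al|.
    have [//|l1] := real_leP (real1 _) (normr_real al).
    move: al3; rewrite real_ltNge ?realn ?rpredX ?normr_real // => /negP[].
    by rewrite (le_trans (exprn_ile1 _ _ (ltW l1))) ?ler1n.
  rewrite (@le_trans _ _ (`|al| ^+ (2 * k.+1 * 2 ^ a.+1))) //.
    by rewrite ltW // (le_lt_trans _ al3) // ler_nat.
  by rewrite ler_weXn2l // leq_mul2r leq_mul2l ltnW ?orbT // -sf.
pose f3 : {poly 'F_3} := map_poly intr f.
have f3m : f3 \is monic by rewrite monic_map.
have [k sf] : exists k, size f = k.+1.
  by exists (size f).-1; rewrite prednK // ltnW.
have sf3 : size f3 = k.+1 by rewrite size_map_poly_id0 ?sf //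
  (monicP fm) rmorph1 oner_neq0.
have s3E : littlewood 'F_3 s = f3 ^+ 2 * map_poly intr r.
  by rewrite -(map_littlewood intr s) sE rmorphM rmorphXn.
have kn : (k < n.+1)%N.
  have := @dvdp_leq _ (f3 ^+ 2) (littlewood 'F_3 s).
  rewrite -size_poly_gt0 size_littlewood s3E dvdp_mulr // => /(_ isT isT).
  rewrite expr2 size_monicM ?monic_neq0 // sf3; lia.
have [g gE] := monic_coefs f3m sf3.
rewrite inE; apply/existsP; exists (Ordinal kn); rewrite /= -ltnS -sf Ksz /=.
by apply/existsP; exists g; rewrite -gE s3E dvdp_mulr.
Qed.

(** * Probability *)

Local Open Scope classical_set_scope.
Local Open Scope ring_scope.

(* On [[-N, N]] the continuous function [|p| + |p'|] attains its infimum, so it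
   vanishes there iff it takes arbitrarily small values at rationals. *)
Lemma measurable_exists_double_root (R : realType) (d : measure_display)
    (T : measurableType d) (p : T -> {poly R}) :
  (forall c, measurable_fun setT (fun w => (p w).[c])) ->
  (forall c, measurable_fun setT (fun w => (p w)^`().[c])) ->
  measurable [set w | exists x, double_root (p w) x].
Proof.
move=> mp mdp.
pose g w y := `|(p w).[y]| + `|(p w)^`().[y]|.
have mg c : measurable_fun setT (g ^~ c).
  by apply: measurable_funD; apply: measurableT_comp.
have cg w : continuous (g w).
  move=> y; apply: cvgD; apply: continuous_comp;
    by [exact: continuous_horner | exact: norm_continuous].
pose A (N j : nat) (q : rat) : set T :=
  [set w | (`|ratr q| < N%:R :> R) && (g w (ratr q) < j.+1%:R^-1)].
have mA N j q : measurable (A N j q).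
  rewrite /A; case: (`|ratr q| < N%:R :> R) => /=; last first.
    by rewrite (_ : [set _ | _] = set0) //; apply/seteqP; split.
  rewrite (_ : [set _ | _] =
      setT `&` (g ^~ (ratr q)) @^-1` `]-oo, (j.+1%:R^-1 : R)[%classic);
        first exact: mg.
  by rewrite setTI; apply/seteqP; split => w /=; rewrite in_itv.
rewrite (_ : [set w | _] = \bigcup_N \bigcap_j \bigcup_q A N j q).
  apply: bigcupT_measurable => N; apply: bigcapT_measurable => j.
  exact: bigcupT_measurable_rat.
apply/seteqP; split => w /=.
  move=> [x [px dpx]].
  have gx0 : g w x = 0 by rewrite /g px dpx normr0 addr0.
  exists (Num.truncn `|x|).+1 => // j _.
  have xN : `|x| < (Num.truncn `|x|).+1%:R by rewrite truncnS_gt.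
  have : \forall y \near x, `|y| < (Num.truncn `|x|).+1%:R /\ g w y <
    j.+1%:R^-1.
    near=> y; split; near: y.
      have := @norm_continuous _ R x => /cvgr_lt; exact.
    by have /cvgr_lt := cg w x; apply; rewrite gx0 invr_gt0.
  move=> /nbhs_ballP[e /= e0 He].
  have [q] := @rat_in_itvoo R (x - e) (x + e) ltac:(by rewrite ltrBlDr -addrA
    ltrDl addr_gt0).
  rewrite in_itv /= => /andP[q1 q2].
  have [|qN gq] := He (ratr q); last by exists q => //; rewrite /A /= qN gq.
  by rewrite /ball /= ltr_distlC q1 q2.
move=> [N _ HN].
have gq j : exists2 y, y \in `[(- N%:R : R), N%:R] & g w y < j.+1%:R^-1.
  have [q _ /= /andP[qN gq]] := HN j I; exists (ratr q) => //.
  by rewrite in_itv /= -ler_norml ltW.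
have N0 : - N%:R <= N%:R :> R by rewrite (le_trans (_ : _ <= 0)) // oppr_le0.
have [c _ cmin] := EVT_min N0 (continuous_subspaceT (cg w)).
exists c; have : g w c <= 0.
  rewrite leNgt; apply/negP => gc.
  (* This index makes [j.+1%:R^-1] smaller than the supposedly positive minimum [g w c]. *)
  have [y yN] := gq (Num.truncn (g w c)^-1).
  rewrite ltNge (le_trans _ (cmin _ yN)) //.
  by rewrite invf_ple ?posrE // ltW // truncnS_gt.
rewrite /g => H.
have /eqP : `|(p w).[c]| + `|(p w)^`().[c]| == 0.
  by rewrite eq_le H addr_ge0.
by move/eqP; rewrite paddr_eq0 ?normr_ge0 // !normr_eq0 => /andP[/eqP ? /eqP].
Unshelve. all: by end_near.
Qed.

Lemma horner_random_poly (R : realType) (d : measure_display)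
    (T : measurableType d) (P : probability T R) n (xi :
      'I_n.+1 -> {RV P >-> R}) w c :
  (random_poly xi w).[c] = \sum_(i < n.+1) xi i w * c ^+ i.
Proof. by rewrite horner_sum; apply: eq_bigr => i _;
  rewrite hornerZ hornerXn. Qed.

Lemma deriv_horner_random_poly (R : realType) (d : measure_display)
    (T : measurableType d) (P : probability T R) n (xi :
      'I_n.+1 -> {RV P >-> R}) w c :
  (random_poly xi w)^`().[c] = \sum_(i < n.+1) xi i w * (c ^+ i.-1 *+ i).
Proof.
rewrite raddf_sum horner_sum; apply: eq_bigr => i _ /=.
by rewrite derivZ derivXn hornerZ hornerMn hornerXn.
Qed.

(** The values 1 and -1 already carry mass [1/2 + 1/2 = 1]; [N] is the event that neither is
    taken. *)
Lemma rademacher_ae (R : realType) (d : measure_display)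
    (T : measurableType d) (P : probability T R) (X : {RV P >-> R}) :
  rademacher X -> exists N : set T,
    [/\ measurable N, P N = 0%E & forall w, ~ N w -> X w = 1 \/ X w = -1].
Proof.
move=> [X1 XN1].
have mX c : measurable [set w | X w = c].
  by rewrite (_ : [set w | _] = X @^-1` [set c]) //; exact: measurable_sfunP.
exists (~` ([set w | X w = 1] `|` [set w | X w = -1])); split.
- by apply: measurableC; exact: measurableU.
- suff PU : P ([set w | X w = 1] `|` [set w | X w = -1]) = 1%E.
    by rewrite probability_setC ?PU ?subee //; exact: measurableU.
  rewrite measureU //; last first.
    apply/seteqP; split => w //= [-> /eqP]; rewrite -subr_eq0 opprK.
    by rewrite -[1 + 1]/(2%:R) pnatr_eq0.
  transitivity ((2^-1)%:E + (2^-1)%:E : \bar R)%E; first by congr (_ + _)%E.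
  by rewrite -EFinD (_ : 2^-1 + 2^-1 = 1 :> R) //; lra.
- by move=> w /contrapT.
Qed.

(** The second event is contained in the first. Their difference is covered by null sets, off which
    all coefficients are signs, and by the events [A s] with [s \in B], each of probability
    [2 ^- n.+1] by independence. *)
Lemma double_root_prob_le (R : realType) (d : measure_display)
    (T : measurableType d) (P : probability T R) n (xi :
      'I_n.+1 -> {RV P >-> R})
    (B : {set {ffun 'I_n.+1 -> bool}}) :
  iid_rademacher xi ->
  (forall s (x : R), root (littlewood R s) x -> root (littlewood R s)^`() x ->
     `|x| != 1 -> s \in B) ->
  `|fine (P [set w | exists x, double_root (random_poly xi w) x]) -
    fine (P [set w | double_root (random_poly xi w) 1 \/
                     double_root (random_poly xi w) (-1)])| <=
  #|B|%:R / 2 ^+ n.+1.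
Proof.
move=> [indep rad] badB.
set E1 := [set w | _]; set E2 := [set w | _ \/ _].
have mp c : measurable_fun setT (fun w => (random_poly xi w).[c]).
  under eq_fun do rewrite horner_random_poly.
  by apply: measurable_sum => i; apply: measurable_funM.
have mdp c : measurable_fun setT (fun w => (random_poly xi w)^`().[c]).
  under eq_fun do rewrite deriv_horner_random_poly.
  by apply: measurable_sum => i; apply: measurable_funM.
have mE1 : measurable E1 by exact: measurable_exists_double_root.
have mdr c : measurable [set w | double_root (random_poly xi w) c].
  rewrite (_ : [set w | _] =
     (setT `&` (fun w => (random_poly xi w).[c]) @^-1` [set 0]) `&`
     (setT `&` (fun w => (random_poly xi w)^`().[c]) @^-1` [set 0])).
    by apply: measurableI; [exact: mp | exact: mdp].
  by rewrite !setTI; apply/seteqP; split.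
have mE2 : measurable E2 by exact: (measurableU _ _ (mdr 1) (mdr (-1))).
have E21 : E2 `<=` E1 by move=> w [] ?; [exists 1 | exists (-1)].
have finP A : measurable A -> P A \is a fin_num by move=> ?;
  exact: fin_num_measure.
have -> : fine (P E1) - fine (P E2) = fine (P (E1 `\` E2)).
  rewrite measureD // ?ltey_eq ?finP // (setIidr E21) fineB ?finP //.
rewrite ger0_norm ?fine_ge0 ?measure_ge0 //.
have /choice [N NP] := fun i => rademacher_ae (rad i).
pose A (s : {ffun 'I_n.+1 -> bool}) : set T :=
  \bigcap_(i in [set` [set: 'I_n.+1]%SET]) (xi i @^-1` [set (-1) ^+ s i]).
have mA s : measurable (A s).
  apply: fin_bigcap_measurable => // i _; exact: measurable_sfunP.
have PA s : P (A s) = (2^-1 ^+ n.+1)%:E.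
  rewrite /A (indep _ (fun i => [set (-1) ^+ s i])) //.
  rewrite (eq_bigr (fun=> (2^-1)%:E)) => [|i _].
    by rewrite prodEFin prodr_const cardsT card_ord.
  by have [X1 XN1] := rad i; case: (s i); rewrite ?expr0 ?expr1.
have sub : E1 `\` E2 `<=` \big[setU/set0]_(i < n.+1) N i `|`
  \big[setU/set0]_(s in B) A s.
  move=> w [[x dx] nE2].
  have [Nw|Nw] := pselect ((\big[setU/set0]_(i < n.+1) N i) w); first by left.
  right; pose s := [ffun i : 'I_n.+1 => xi i w == -1].
  have xiE i : xi i w = (-1) ^+ s i.
    have [_ _ /(_ w)] := NP i.
    have Niw : ~ N i w by move=> Ni; apply: Nw; rewrite -bigcup_seq;
      exists i => //=; rewrite mem_index_enum.
    move=> /(_ Niw) [] e; rewrite ffunE e.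
      by rewrite -subr_eq0 opprK -[1 + 1]/(2%:R) pnatr_eq0.
    by rewrite eqxx expr1.
  have pE : random_poly xi w = littlewood R s.
    by apply: eq_bigr => i _; rewrite xiE.
  rewrite -bigcup_seq_cond; exists s => /=; last by move=> i _ /=; rewrite xiE.
  rewrite mem_index_enum /=; apply: (badB s x); rewrite /root -?pE.
  - by rewrite dx.1.
  - by rewrite dx.2.
  - apply/negP; rewrite eqr_norml ler01 andbT => /orP[]/eqP xE; apply: nE2.
      by left; rewrite -xE.
    by right; rewrite -xE.
have mN : measurable (\big[setU/set0]_(i < n.+1) N i).
  by apply: bigsetU_measurable => i _; have [] := NP i.
have mB : measurable (\big[setU/set0]_(s in B) A s) by exact:
  bigsetU_measurable.
have PN : P (\big[setU/set0]_(i < n.+1) N i) = 0%E.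
  have [_ ->//] : measurable (\big[setU/set0]_(i < n.+1) N i) /\ P
    (\big[setU/set0]_(i < n.+1) N i) = 0%E.
  elim/big_rec: _ => [|i X _ [mX PX]]; first by split.
  have [mNi PNi _] := NP i; split; first exact: measurableU.
  exact: null_set_setU.
have PB : (P (\big[setU/set0]_(s in B) A s) <= (#|B|%:R * 2^-1 ^+ n.+1)%:E)%E.
  apply: (@le_trans _ _ (\sum_(s in B) P (A s))%E); last first.
    by rewrite (eq_bigr _ (fun s _ => PA s)) sumEFin sumr_const mulr_natl.
  suff [] : measurable (\big[setU/set0]_(s in B) A s) /\
     (P (\big[setU/set0]_(s in B) A s) <= \sum_(s in B) P (A s))%E by [].
  elim/big_rec2: _ => [|s y X _ [mX PX]]; first by rewrite measure0.
  split; first exact: measurableU.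
  by apply: le_trans (measureU2 _ _ _) _ => //; apply: leeD.
rewrite -lee_fin fineK ?finP //; last exact: measurableD.
rewrite -exprVn; apply: le_trans PB.
rewrite -[leRHS]add0e -PN; apply: le_trans (measureU2 _ _ _) => //.
apply: le_measure => //; rewrite inE //;
  [exact: measurableD | exact: measurableU].
Qed.

(** * Asymptotics *)

(** With [t = L %/ 8], one has [L <= 8 * 2 ^ t], hence [A * L ^ 4 <= 4096 * A * 2 ^ (4 * t)], where
    [4096 * A <= t <= 2 ^ (4 * t)]. *)
Lemma pow4_le_exp2 A L : (8 * (4096 * A) <= L)%N -> (A * L ^ 4 <= 2 ^ L)%N.
Proof.
move=> AL; set t := (L %/ 8)%N.
have tA : (4096 * A <= t)%N by rewrite leq_divRL // mulnC.
have Lt : (L <= 8 * 2 ^ t)%N.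
  have := ltn_expl t (ltnSn 1); have := divn_eq L 8;
    have := ltn_pmod L (ltn0Sn 7).
  by rewrite -/t; lia.
apply: (@leq_trans (A * (8 * 2 ^ t) ^ 4)%N);
  first by rewrite leq_mul2l leq_exp2r ?Lt ?orbT.
apply: (@leq_trans (2 ^ (8 * t))%N);
  last by rewrite leq_exp2l // mulnC leq_trunc_div.
rewrite expnMn mulnA (mulnC A) -(expnM 2 t 4) (_ : 8 * t = t * 4 + t * 4)%N;
  last by lia.
rewrite expnD leq_mul2r; apply/orP; right; rewrite (leq_trans tA) //.
by rewrite (leq_trans (ltnW (ltn_expl t (ltnSn 1)))) // leq_exp2l // leq_pmulr.
Qed.

Lemma card_real_double_root_small (R : rcfType) (q : nat) :
  exists n0, forall n, (n0 <= n)%N ->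
  exists B : {set {ffun 'I_n.+1 -> bool}},
    (forall s (x : R), root (littlewood R s) x -> root (littlewood R s)^`() x ->
       `|x| != 1 -> s \in B) /\ (#|B| * n ^ q <= 2 ^ n.+1)%N.
Proof.
(* [A * L ^ 4] is [5 * K ^ 2 * (24 * K ^ 2)] for the [K] chosen below: the first factor bounds the
   exponent [2 * K.+1 * K + e], the second bounds [m]. *)
pose A := (120 * (3 * (q + 2)) ^ 4)%N; pose L0 := (8 * (4096 * A) + q + 2)%N.
exists (2 ^ L0)%N => n n0; pose L := trunc_log 2 n.
have n_gt0 : (0 < n)%N by rewrite (leq_trans _ n0) // expn_gt0.
have [nL nL1] : (2 ^ L <= n /\ n < 2 ^ L.+1)%N.
  by rewrite /L trunc_logP // trunc_log_ltn.
have LL0 : (L0 <= L)%N by rewrite -ltnS -(ltn_exp2l _ _ (ltnSn 1))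
  (leq_ltn_trans n0).
have qL : (q + 2 <= L)%N by rewrite (leq_trans _ LL0) // /L0 -addnA leq_addl.
have AL : (A * L ^ 4 <= 2 ^ L)%N by apply: pow4_le_exp2;
  rewrite (leq_trans _ LL0) // /L0 -addnA leq_addr.
(* As [2 * 3 ^ 3 <= 4 ^ 3], this gives [2 ^ ((q + 2) * L) * 3 ^ K <= 4 ^ K], and the power of 2
   absorbs both [n.+1] and [2 ^ e]. *)
have [K KE] : exists K, K = (3 * (q + 2) * L)%N by eexists.
have K0 : (0 < K)%N by rewrite KE !muln_gt0 /= addn2 /=; lia.
pose a := trunc_log 2 (6 * K).
have Ka : (6 * K < 2 ^ a.+1)%N by rewrite trunc_log_ltn.
have aK : (2 ^ a.+1 <= 12 * K)%N.
  have : (2 ^ a <= 6 * K)%N by rewrite trunc_logP // muln_gt0.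
  by rewrite expnS; lia.
have [B [BP [b [c [Bbc bP cP]]]]] := card_real_double_root R n K0 Ka.
exists B; split=> //.
set m := (2 * K * 2 ^ a.+1)%N in bP.
have m0 : (0 < m)%N by rewrite !muln_gt0 K0 expn_gt0.
(* Since [n < 2 ^ L.+1], [2 ^ e] is at least [2 * n ^ q]; the extra 2 leaves half of the bound to
   each of [b] and [c]. *)
pose e := (q * L.+1).+1.
have eE : e = (q * L + q + 1)%N by rewrite /e mulnS; lia.
have b_small : (b * 2 ^ e <= 2 ^ n.+1)%N.
  have De : ((2 * 3 ^ K).+1 ^ K * 2 ^ e <= 2 ^ (n %/ m))%N.
    have D1 : ((2 * 3 ^ K).+1 <= 2 ^ (2 * K.+1))%N.
      apply: (@leq_trans (3 ^ K.+1)); first by rewrite expnS;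
        have := expn_gt0 3 K; lia.
      by rewrite expnM leq_exp2r.
    apply: (@leq_trans (2 ^ (2 * K.+1 * K + e))).
      by rewrite expnD leq_mul2r expnM leq_exp2r // D1 orbT.
    rewrite leq_exp2l // leq_divRL //.
    have KK : (K <= K * K)%N by rewrite ssrnat.leq_pmulr.
    have eK : (e <= K)%N by rewrite eE KE -mulnA mulnDl; lia.
    apply: (@leq_trans (5 * K ^ 2 * (24 * K ^ 2))).
      apply: leq_mul; first by rewrite -mulnn; lia.
      by rewrite (leq_trans (leq_mul (leqnn _) aK)) // -mulnn; lia.
    apply: leq_trans nL; apply: leq_trans AL.
    by rewrite mulnACA -expnD /A KE [((_ * L) ^ _)%N]expnMn mulnA.
  rewrite -(leq_pmul2r (_ : 0 < 2 ^ (n %/ m))%N) ?expn_gt0 // mulnAC.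
  rewrite (leq_trans (leq_mul bP (leqnn (2 ^ e)%N))) //.
  by rewrite mulnAC (mulnC _ (2 ^ n.+1)%N) leq_mul2l De orbT.
have c_small : (c * 2 ^ e <= 2 ^ n.+1)%N.
  have De : (n.+1 * 3 ^ K * 2 ^ e <= 4 ^ K)%N.
    apply: (@leq_trans (2 ^ ((q + 2) * L) * 3 ^ K)).
      rewrite mulnAC leq_mul2r; apply/orP; right.
      apply: (@leq_trans (2 ^ L.+1 * 2 ^ e));
        first by rewrite leq_mul2r nL1 orbT.
      by rewrite -expnD leq_exp2l //; rewrite /e; nia.
    rewrite KE -mulnA !(expnM _ 3) -expnMn.
    case: ((q + 2) * L)%N => // j; by rewrite leq_exp2r.
  rewrite -(leq_pmul2r (_ : 0 < 4 ^ K)%N) ?expn_gt0 // mulnAC.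
  rewrite (leq_trans (leq_mul cP (leqnn (2 ^ e)%N))) //.
  by rewrite mulnAC (mulnC _ (2 ^ n.+1)%N) leq_mul2l De orbT.
have nq : (n ^ q * 2 <= 2 ^ e)%N.
  rewrite /e expnSr leq_mul2r mulnC expnM /=.
  by case: (q) => // q'; rewrite leq_exp2r // ltnW.
rewrite -(leq_pmul2r (ltn0Sn 1)) -mulnA (leq_trans (leq_mul Bbc nq)) //.
by rewrite mulnDl muln2 -addnn leq_add.
Qed.

Theorem theorem1p8 (R : realType)
  (d : nat -> measure_display) (T : forall n : nat, measurableType (d n))
  (P : forall n : nat, probability (T n) R)
  (xi : forall n : nat, 'I_n.+1 -> {RV (P n) >-> R})
  (xi_iid : forall n : nat, iid_rademacher (@xi n)) :
  superpolynomially_small (fun n : nat =>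
    fine (P n [set w | exists x : R, double_root (random_poly (@xi n) w) x]) -
    fine (P n [set w | double_root (random_poly (@xi n) w) 1 \/
                       double_root (random_poly (@xi n) w) (-1)])).
Proof.
(* [q] is an integer exponent larger than [C]; starting from [n0.+1] ensures [n >= 1], so that
   [n ^ -q <= n ^ -C]. *)
move=> C C0; pose q := (Num.truncn C).+1.
have [n0 Hn0] := card_real_double_root_small R q.
exists n0.+1 => // n /= nn0.
have [B [BP cB]] := Hn0 n (ltnW nn0).
apply: (le_trans (double_root_prob_le (xi_iid n) BP)).
have n1 : 1 <= n%:R :> R by rewrite ler1n (leq_trans _ nn0).
have n_gt0 : 0 < n%:R :> R := lt_le_trans ltr01 n1.
apply: (@le_trans _ _ (n%:R ^+ q)^-1).
  by rewrite ler_pdivrMr ?exprn_gt0 // ler_pdivlMl ?exprn_gt0 //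
    mulrC -!natrX -natrM ler_nat.
rewrite powRN lef_pV2 ?posrE ?exprn_gt0 ?powR_gt0 //.
by rewrite -powR_mulrn ?ler0n // ler_powR // ltW // /q truncnS_gt.
Qed.
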